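(* Let $\mathbb{K}$ be a field and let $\mathcal{S}\subsetneq\mathbb{N}$ be a numerical semigroup with minimal generating set $A=\{a_1,\ldots,a_m\}$. Then $\mathcal{S}$ is free if and only if the toric ideal $I_{\mathcal{S}}\subseteq\mathbb{K}[x_1,\ldots,x_m]$ has a Gröbner basis (with respect to some monomial order) with $m-1$ elements.
   Context: A numerical semigroup is a submonoid $\mathcal{S}$ of $(\mathbb{N},+)$ with finite complement; it has a unique minimal generating set $A=\{a_1,\ldots,a_m\}\subseteq\mathbb{Z}^+$, which is finite with $\gcd(a_1,\ldots,a_m)=1$. The toric ideal $I_{\mathcal{S}}\subseteq\mathbb{K}[x_1,\ldots,x_m]$ is generated by all binomials $\mathbf{x}^{\mathbf{u}}-\mathbf{x}^{\mathbf{v}}$ with $\sum_i u_ia_i=\sum_i v_ia_i$. $\mathcal{S}$ is free for the arrangement $a_1,\ldots,a_m$ (an ordering of the minimal generators) if $\mathrm{lcm}(a_i,\gcd(a_{i+1},\ldots,a_m))\in\langle a_{i+1},\ldots,a_m\rangle$ for all $i\in\{1,\ldots,m-1\}$, where $\langle b_1,\ldots,b_k\rangle$ is the set of $\mathbb{N}$-linear combinations of $b_1,\ldots,b_k$. $\mathcal{S}$ is free if it is free for some arrangement of its minimal generating set. *)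

(* Defs.v *)
From mathcomp Require Import all_boot all_order all_algebra.
From mathcomp Require Import mpoly.

Set Implicit Arguments.
Unset Strict Implicit.
Unset Printing Implicit Defensive.

Import GRing.Theory.
Local Open Scope ring_scope.

Definition numerical_semigroup (S : nat -> Prop) : Prop :=
  [/\ S 0%N,
      forall x y : nat, S x -> S y -> S (x + y)%N
    & exists gaps : seq nat, forall x : nat, ~ S x -> x \in gaps].

Definition nat_span (b : seq nat) (n : nat) : Prop :=
  exists u : 'I_(size b) -> nat, n = (\sum_(i < size b) u i * nth 0 b i)%N.

Definition generates (S : nat -> Prop) (b : seq nat) : Prop :=
  forall n : nat, S n <-> nat_span b n.

(* The sequence [b] lists, in some order and without repetition, a generating
   set of [S] that is minimal for inclusion. *)
Definition minimal_generators (S : nat -> Prop) (b : seq nat) : Prop :=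
  [/\ uniq b, generates S b
    & forall c : seq nat,
        {subset c <= b} -> generates S c -> {subset b <= c}].

(* Indices are 0-based: [nth 0 b i] is a_(i+1), and [drop i.+1 b] lists
   a_(i+2), ..., a_m. *)
Definition free_for (b : seq nat) : Prop :=
  forall i : nat, (i.+1 < size b)%N ->
    nat_span (drop i.+1 b)
      (lcmn (nth 0%N b i) (\big[gcdn/0%N]_(x <- drop i.+1 b) x)).

Definition free_semigroup (S : nat -> Prop) : Prop :=
  exists2 b : seq nat, minimal_generators S b & free_for b.

Definition ideal_generated (R : comNzRingType) (P : R -> Prop) (f : R) : Prop :=
  exists2 s : seq (R * R),
    forall x : R * R, x \in s -> P x.2 & f = \sum_(x <- s) x.1 * x.2.

Definition toric_ideal (K : fieldType) (m : nat) (a : m.-tuple nat) :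
    {mpoly K[m]} -> Prop :=
  ideal_generated (fun f => exists u v : 'X_{1..m},
    (\sum_(i < m) u i * tnth a i = \sum_(i < m) v i * tnth a i)%N
    /\ f = 'X_[K, u] - 'X_[K, v]).

(* [le u v] compares the monomials with exponent vectors [u] and [v]; the
   product of monomials is [+%MM] and the monomial 1 is [0%MM]. *)
Definition monomial_order (m : nat) (le : rel 'X_{1..m}) : Prop :=
  [/\ antisymmetric le, transitive le, total le,
      forall u : 'X_{1..m}, le 0%MM u
    & forall u v w : 'X_{1..m}, le u v -> le (u + w)%MM (v + w)%MM].

(* No monomial is the leading monomial of the zero polynomial. *)
Definition leading_monomial (K : fieldType) (m : nat) (le : rel 'X_{1..m})
    (f : {mpoly K[m]}) (u : 'X_{1..m}) : Prop :=
  u \in msupp f /\ forall v : 'X_{1..m}, v \in msupp f -> le v u.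

(* Since [K] is a field, leading monomials and leading terms generate the same
   ideal. *)
Definition initial_ideal (K : fieldType) (m : nat) (le : rel 'X_{1..m})
    (F : {mpoly K[m]} -> Prop) : {mpoly K[m]} -> Prop :=
  ideal_generated (fun f => exists g u,
    [/\ F g, leading_monomial le g u & f = 'X_[K, u]]).

Definition groebner_basis (K : fieldType) (m : nat) (le : rel 'X_{1..m})
    (I : {mpoly K[m]} -> Prop) (G : seq {mpoly K[m]}) : Prop :=
  [/\ 0 \notin G,
      forall g : {mpoly K[m]}, g \in G -> I g
    & forall f : {mpoly K[m]},
        initial_ideal le I f <-> initial_ideal le (fun g => g \in G) f].

(* Main.v *)
Require Import Defs.
From mathcomp Require Import all_boot all_order all_algebra all_fingroup.
From mathcomp Require Import mpoly zify ring.

(** Give the monomial [x^u] the weight [sum_i u_i a_i]. The toric ideal contains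
    [x^u - x^v] whenever the two weights agree, and conversely, in an element of
    the ideal the coefficients in each weight sum to 0, so that no monomial is
    alone in its weight ([toric_ideal_partner]). Therefore, for any monomial
    order, the monomials that are not leading monomials of the ideal are the
    least ones in their weights, and no two of them share a weight.

    From free to Groebner: for a free arrangement put [c_i] equal to
    [lcm (a_i, gcd (a_(i+1), ..., a_m)) / a_i]. Freeness provides, for [i < m], a
    monomial [x^(v_i)] in the variables after [x_i] with the weight of
    [x_i^(c_i)], and the lexicographic leading monomial of [x_i^(c_i) - x^(v_i)]
    is [x_i^(c_i)]. If [x^u] exceeds [x^v] lexicographically and has the same
    weight, then at the first index [i] where they differ [(u_i - v_i) a_i] is
    divisible by [a_i] and by the gcd of the later generators, whence
    [c_i <= u_i] ([lex_larger_divisible]). So the [m - 1] pure powers generate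
    the initial ideal.

    From Groebner to free: one of [x_i^(a_j)], [x_j^(a_i)] is a leading monomial
    of [x_i^(a_j) - x_j^(a_i)], so all variables except at most one have a power
    in the initial ideal. A generator that divides such a power is itself a pure
    power, and there are only [m - 1] generators: they are exactly [x_i^(c_i)]
    for [i <> j0] ([pure_power_leading_monomials]). Every [x_i^(c_i)] has a
    smaller monomial [x^(tail i)] of the same weight. The dependency graph of
    the tails has no cycle: multiplying the relations along a set of variables
    each of which occurs in some tail of the set, and cancelling common factors,
    would produce a leading monomial that no [x_i^(c_i)] divides
    ([exists_source]). Listing the variables so that each tail uses only later
    ones, with [j0] last, gives [c_i a_i] in the span of the later generators;
    and [c_i a_i] is the required lcm, since a smaller exponent would give two
    monomials of the same weight outside the initial ideal ([free_arrangement]). *)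

Set Implicit Arguments.
Unset Strict Implicit.
Unset Printing Implicit Defensive.

(** * Spans of sequences and minimal generating sets *)

Lemma nat_span_nil n : nat_span [::] n <-> n = 0.
Proof.
split=> [[u ->]|->]; first by rewrite big_ord0.
by exists (fun=> 0); rewrite big_ord0.
Qed.

Lemma nat_span_cons x s n :
  nat_span (x :: s) n <-> exists k r, n = k * x + r /\ nat_span s r.
Proof.
split=> [[u ->]|[k [_ [-> [u ->]]]]].
  exists (u ord0), (\sum_(i < size s) u (lift ord0 i) * nth 0 s i).
  by rewrite big_ord_recl; split=> //; exists (fun i => u (lift ord0 i)).
exists (fun i => if unlift ord0 i is Some j then u j else k).
rewrite big_ord_recl /= unlift_none; congr (_ + _).
by apply: eq_bigr => i _; rewrite liftK.
Qed.

Lemma nat_span0 s : nat_span s 0.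
Proof.
elim: s => [|x s IH]; first exact/nat_span_nil.
by apply/nat_span_cons; exists 0, 0.
Qed.

Lemma nat_spanD s n p : nat_span s n -> nat_span s p -> nat_span s (n + p).
Proof.
case=> u -> [v ->]; exists (fun i => u i + v i).
by rewrite -big_split; apply: eq_bigr => i _; rewrite mulnDl.
Qed.

Lemma nat_spanM s k n : nat_span s n -> nat_span s (k * n).
Proof.
case=> u ->; exists (fun i => k * u i).
by rewrite big_distrr; apply: eq_bigr => i _; rewrite /= mulnA.
Qed.

Lemma mem_nat_span (s : seq nat) x : x \in s -> nat_span s x.
Proof.
elim: s => // y s IH; rewrite inE => /predU1P[->|/IH xs]; apply/nat_span_cons.
  by exists 1, 0; rewrite mul1n addn0; split=> //; apply: nat_span0.
by exists 0, x.
Qed.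

Lemma nat_span_trans (s t : seq nat) n :
  (forall x, x \in s -> nat_span t x) -> nat_span s n -> nat_span t n.
Proof.
elim: s n => [|x s IH] n st; first by move/nat_span_nil->; apply: nat_span0.
case/nat_span_cons=> k [r [-> sr]]; apply: nat_spanD.
  by apply: nat_spanM; apply: st; rewrite mem_head.
by apply: IH => // y ys; apply: st; rewrite inE ys orbT.
Qed.

Lemma dvdn_nat_span (s : seq nat) n :
  nat_span s n -> \big[gcdn/0]_(x <- s) x %| n.
Proof.
elim: s n => [|x s IH] n; first by move/nat_span_nil->.
case/nat_span_cons=> k [r [-> /IH sr]]; rewrite big_cons.
apply: dvdn_add; first by rewrite dvdn_mull // dvdn_gcdl.
exact: dvdn_trans (dvdn_gcdr _ _) sr.
Qed.

(** The Bezout relation expressing [n] has negative coefficients; adding a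
    multiple of the last argument [y] absorbs them. *)
Lemma gcd_multiple_span (s : seq nat) y n :
  0 < y -> {in s, forall x, 0 < x} -> \big[gcdn/0]_(x <- s) x %| n ->
  exists N, nat_span s (n + N * y).
Proof.
move=> y0; elim: s n => [|x s IH] n s0.
  by rewrite big_nil dvd0n => /eqP->; exists 0; apply: nat_span0.
rewrite big_cons; set g := \big[gcdn/0]_(z <- s) z => /dvdnP[q nq].
have x0 : 0 < x by apply: s0; rewrite mem_head.
case: (egcdnP g x0) nq => k l kl _ nq.
(* [n = q k x - q l g], and [- q l g] is congruent to [q l g (y - 1)] mod y *)
have [z zs||N sN] := IH (q * l * g * y.-1).
- by apply: s0; rewrite inE zs orbT.
- by rewrite dvdn_mulr // dvdn_mull.
exists (q * l * g + N); apply/nat_span_cons.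
exists (q * k), (q * l * g * y.-1 + N * y); split=> //.
have -> : q * k * x = q * l * g + n by rewrite -mulnA kl mulnDr mulnA -nq.
by case: y y0 {IH sN} => // y _ /=; ring.
Qed.

(** The reason why an element that does not decompose in the span must be one
    of the generators. *)
Lemma nat_span_split (s : seq nat) n : nat_span s n ->
  n = 0 \/ exists x r, [/\ x \in s, x != 0, nat_span s r & n = x + r].
Proof.
elim: s n => [|y s IH] n; first by move/nat_span_nil; left.
case/nat_span_cons=> k [r [-> sr]].
have [ky0|ky0] := eqVneq (k * y) 0.
  rewrite ky0 add0n; case: (IH r sr) => [->|[x [t [xs x0 st ->]]]]; first by left.
  right; exists x, t; split=> //; first by rewrite inE xs orbT.
  by apply/nat_span_cons; exists 0, t.
move: ky0; rewrite muln_eq0 negb_or => /andP[k0 y0].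
right; exists y, (k.-1 * y + r); split=> //; first exact: mem_head.
  by apply/nat_span_cons; exists k.-1, r.
by case: k k0 => // k _; rewrite mulSn addnA.
Qed.

(** A generator larger than [n] can only occur with coefficient 0. *)
Lemma nat_span_lt (s : seq nat) x n : n < x ->
  nat_span s n -> nat_span [seq y <- s | y != x] n.
Proof.
elim: s n => // y s IH n nx /nat_span_cons[k [r [nE sr]]] /=.
have rx : r < x by apply: leq_ltn_trans nx; rewrite nE leq_addl.
have [yx|yx] := eqVneq y x; last first.
  by apply/nat_span_cons; exists k, r; split=> //; apply: IH.
suff -> : n = r by exact: IH.
by case: k nE nx => // k ->; rewrite yx mulSn -addnA ltnNge leq_addr.
Qed.

(** Minimality in the form that is used below: were [x] redundant, the other
    members of [b] would still generate [S]. *)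
Lemma minimal_generators_irredundant S (b : seq nat) x :
  minimal_generators S b -> x \in b -> ~ nat_span [seq y <- b | y != x] x.
Proof.
case=> _ gen min xb bx; suff /min bsub : generates S [seq y <- b | y != x].
  have : x \in [seq y <- b | y != x].
    by apply: bsub => // y; rewrite mem_filter => /andP[].
  by rewrite mem_filter eqxx.
move=> n; split=> [/gen|]; last first.
  move=> bn; apply/gen; apply: nat_span_trans bn => y.
  by rewrite mem_filter => /andP[_]; apply: mem_nat_span.
apply: nat_span_trans => y yb; have [->//|yx] := eqVneq y x.
by apply: mem_nat_span; rewrite mem_filter yx.
Qed.

Lemma minimal_generators_gt0 S (b : seq nat) x :
  minimal_generators S b -> x \in b -> 0 < x.
Proof.
move=> minb xb; rewrite lt0n; apply/eqP => x0.
by apply: (minimal_generators_irredundant minb xb); rewrite x0; apply: nat_span0.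
Qed.

(** Minimal generators cannot be decomposed inside [S], hence they belong to
    every generating set. *)
Lemma minimal_generators_sub S (b c : seq nat) :
  minimal_generators S b -> generates S c -> {subset b <= c}.
Proof.
move=> minb genc x xb; have [_ genb _] := minb.
have /genc/nat_span_split : S x by apply/genb; apply: mem_nat_span.
case=> [x0|[y [r [yc y0 cr xE]]]].
  by have := minimal_generators_gt0 minb xb; rewrite x0.
have [r0|r0] := eqVneq r 0; first by rewrite xE r0 addn0.
case: (minimal_generators_irredundant minb xb); rewrite {2}xE; apply: nat_spanD.
  apply: nat_span_lt; first by rewrite xE -[X in X < _]addn0 ltn_add2l lt0n.
  by apply/genb/genc; apply: mem_nat_span.
apply: nat_span_lt; first by rewrite xE -[X in X < _]add0n ltn_add2r lt0n.
exact/genb/genc.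
Qed.

Lemma minimal_generators_perm_eq S (b c : seq nat) :
  minimal_generators S b -> minimal_generators S c -> perm_eq b c.
Proof.
move=> minb minc; have [ub genb _] := minb; have [uc genc _] := minc.
apply: uniq_perm => // x; apply/idP/idP.
  exact: (minimal_generators_sub minb genc).
exact: (minimal_generators_sub minc genb).
Qed.

Lemma perm_minimal_generators S (b c : seq nat) :
  perm_eq b c -> minimal_generators S b -> minimal_generators S c.
Proof.
move=> bc [ub genb minb]; have bcE := perm_mem bc.
split; first by rewrite -(perm_uniq bc).
  move=> n; apply: iff_trans (genb n) _.
  by split; apply: nat_span_trans => x xb; apply: mem_nat_span;
    rewrite ?bcE // -bcE.
move=> d dc gend x xc; apply: (minb d) => //; last by rewrite bcE.
by move=> y /dc; rewrite bcE.
Qed.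

Lemma free_for_cons x s : free_for (x :: s) <->
  (s <> [::] -> nat_span s (lcmn x (\big[gcdn/0]_(y <- s) y))) /\ free_for s.
Proof.
split=> [fr|[frx frs] [|i] lt_i /=]; last 1 first.
- exact: frs.
- split=> [s0|i lt_i]; last exact: (fr i.+1).
  by have := fr 0; rewrite /= drop0; apply; case: s s0 {fr}.
by rewrite drop0; apply: frx => s0; rewrite s0 in lt_i.
Qed.

(** * Weights of monomials and leading monomials of toric binomials *)

Definition weight m (a : m.-tuple nat) (u : 'X_{1..m}) : nat :=
  \sum_(i < m) u i * tnth a i.

Lemma weight0 m (a : m.-tuple nat) : weight a 0%MM = 0.
Proof. by apply: big1 => i _; rewrite mnm0E. Qed.

Lemma weightD m (a : m.-tuple nat) u v :
  weight a (u + v)%MM = weight a u + weight a v.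
Proof. by rewrite -big_split; apply: eq_bigr => i _; rewrite mnmDE mulnDl. Qed.

Lemma weight_sum m (a : m.-tuple nat) I (r : seq I) (P : pred I) F :
  weight a (\sum_(i <- r | P i) F i)%MM = \sum_(i <- r | P i) weight a (F i).
Proof. exact: (big_morph _ (@weightD m a) (@weight0 m a)). Qed.

Lemma mnm1MnE m (i j : 'I_m) k : (U_(i) *+ k)%MM j = (i == j) * k.
Proof. by rewrite mulmnE mnm1E. Qed.

Lemma weight1Mn m (a : m.-tuple nat) i k :
  weight a (U_(i) *+ k)%MM = k * tnth a i.
Proof.
rewrite /weight (bigD1 i) //= big1 ?addn0 => [|j ji].
  by rewrite mnm1MnE eqxx mul1n.
by rewrite mnm1MnE eq_sym (negPf ji).
Qed.

(** The bridge between semigroup conditions and binomials: a relation in the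
    span becomes a monomial in the variables listed in [e]. *)
Lemma nat_span_weight m (a : m.-tuple nat) (e : seq 'I_m) n : uniq e ->
  nat_span [seq tnth a i | i <- e] n <->
  exists2 w : 'X_{1..m}, (forall i, i \notin e -> w i = 0) & weight a w = n.
Proof.
elim: e n => [|i e IH] n /=.
  move=> _; apply: iff_trans (nat_span_nil n) _; split=> [->|[w w0 <-]].
    by exists 0%MM; rewrite ?weight0 // => j _; rewrite mnm0E.
  by apply: big1 => j _; rewrite w0.
case/andP=> ie ue; apply: iff_trans (nat_span_cons _ _ _) _; split.
  case=> k [r [-> /(IH _ ue)[w w0 <-]]].
  exists (U_(i) *+ k + w)%MM; last by rewrite weightD weight1Mn.
  move=> j; rewrite inE negb_or => /andP[ji je].
  by rewrite mnmDE mnm1MnE eq_sym (negPf ji) w0.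
case=> w w0 <-; pose r : 'X_{1..m} := [multinom if j == i then 0 else w j | j < m].
exists (w i), (weight a r); split; last first.
  apply/(IH _ ue); exists r => // j je; rewrite mnmE.
  by case: eqVneq => // ji; rewrite w0 // inE negb_or ji.
rewrite -weight1Mn -weightD; congr weight; apply/mnmP => j.
rewrite mnmDE mnm1MnE mnmE eq_sym; case: eqVneq => [->|_]; first by rewrite addn0 mul1n.
by rewrite mul0n.
Qed.

Section ToricIdeal.
Local Open Scope ring_scope.
Import GRing.Theory.

Variables (K : fieldType) (m : nat) (a : m.-tuple nat).
Implicit Types (f g : {mpoly K[m]}) (u v w : 'X_{1..m}).

Lemma toric_binomial u v : weight a u = weight a v ->
  toric_ideal a ('X_[K, u] - 'X_[K, v]).
Proof.
move=> uv; exists [:: (1, 'X_[K, u] - 'X_[K, v])] => [x|].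
  by rewrite inE => /eqP->; exists u, v.
by rewrite big_seq1 mul1r.
Qed.

(** Substituting [t ^ a_i] for [x_i] kills the toric ideal. The coefficient of
    [t ^ d] in the image of [f] is the sum of the coefficients of [f] in weight
    [d], so no monomial of [f] can be alone in its weight. *)
Lemma toric_ideal_partner f u : toric_ideal a f -> u \in msupp f ->
  exists v, [/\ v \in msupp f, v != u & weight a v = weight a u].
Proof.
pose t i : {poly K} := 'X^(tnth a i).
have mmap1E w : mmap1 t w = 'X^(weight a w).
  rewrite /mmap1 /weight (big_morph _ (@exprD _ 'X) (expr0 _)).
  by apply: eq_bigr => i _; rewrite -exprM mulnC.
case=> s sP fE uf; have f0 : mmap polyC t f = 0.
  rewrite fE rmorph_sum /= big_seq big1 // => x /sP[v [w [vw xE]]].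
  by rewrite rmorphM /= xE mmapB !mmapX !mmap1E /weight vw subrr mulr0.
have [/hasP[v vf /andP[vu /eqP wvu]]|/hasPn alone] :=
  boolP (has (fun v => (v != u) && (weight a v == weight a u)) (msupp f)).
  by exists v.
have /eqP[] : f@_u != 0 by rewrite -mcoeff_msupp.
have /(congr1 (coefp (weight a u))) := f0.
rewrite /= coef0 /mmap coef_sum (bigD1_seq u) ?msupp_uniq //=.
rewrite mmap1E coefCM coefXn eqxx mulr1 big_seq_cond big1 ?addr0 //.
move=> v /andP[vf vu]; rewrite mmap1E coefCM coefXn.
have := alone v vf; rewrite vu /= eq_sym => /negPf ->.
by rewrite mulr0.
Qed.

Variable le : rel 'X_{1..m}.

Lemma initial_ideal_sub (F G : {mpoly K[m]} -> Prop) f :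
  (forall g u, F g -> leading_monomial le g u ->
     initial_ideal le G 'X_[K, u]) ->
  initial_ideal le F f -> initial_ideal le G f.
Proof.
move=> FG [s sP ->] {f}; elim: s sP => [|x s IH] sP.
  by exists [::]; rewrite ?big_nil.
have [|s1 s1P s1E] := IH; first by move=> y ys; apply: sP; rewrite inE ys orbT.
have [g [u [Fg gu x2E]]] := sP x (mem_head _ _).
have [s2 s2P s2E] := FG g u Fg gu.
exists ([seq (x.1 * y.1, y.2) | y <- s2] ++ s1) => [y|].
  by rewrite mem_cat => /orP[/mapP[z /s2P Pz ->]|/s1P].
rewrite big_cons big_cat s1E /= big_map x2E s2E mulr_sumr.
by congr (_ + _); apply: eq_bigr => y _; rewrite mulrA.
Qed.

Lemma leading_initial_ideal (F : {mpoly K[m]} -> Prop) g w u :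
  F g -> leading_monomial le g w -> (w <= u)%MM ->
  initial_ideal le F 'X_[K, u].
Proof.
move=> Fg gw wu; exists [:: ('X_[K, u - w], 'X_[K, w])] => [x|].
  by rewrite inE => /eqP->; exists g, w.
by rewrite big_seq1 -mpolyXD submK.
Qed.

(** In an expression of [x^u] by monomials, some summand has a nonzero
    coefficient at [u]. *)
Lemma initial_ideal_leading (F : {mpoly K[m]} -> Prop) u :
  initial_ideal le F 'X_[K, u] ->
  exists g w, [/\ F g, leading_monomial le g w & (w <= u)%MM].
Proof.
case=> s sP uE; have : ('X_[K, u])@_u != 0 by rewrite mcoeffX eqxx oner_neq0.
rewrite uE linear_sum /=.
have [/hasP[x xs xu]|/hasPn no] := boolP (has (fun x => (x.1 * x.2)@_u != 0) s).
  move=> _; have [g [w [Fg gw xE]]] := sP x xs.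
  exists g, w; split=> //; move: xu; rewrite -mcoeff_msupp => /msuppM_le.
  case/allpairsP=> -[v z] [_ /=]; rewrite xE msuppX inE => /eqP-> ->.
  exact: lem_addl.
by rewrite big_seq big1 ?eqxx // => x /no; rewrite negbK => /eqP.
Qed.

Hypothesis le_order : monomial_order le.

Lemma leading_monomial_unique f u v :
  leading_monomial le f u -> leading_monomial le f v -> u = v.
Proof.
case=> uf fu [vf fv]; have [anti _ _ _ _] := le_order.
by apply: anti; rewrite fu // fv.
Qed.

Lemma leading_monomial_exists f : f != 0 -> exists u, leading_monomial le f u.
Proof.
have [_ tr tot _ _] := le_order.
have le_refl v : le v v by have := tot v v; rewrite orbb.
rewrite -msupp_eq0 /leading_monomial; elim: (msupp f) => // v s IH _.
have [->|/IH[u [us su]]] := eqVneq s [::].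
  by exists v; split=> [|w]; rewrite inE // => /eqP->.
have /orP[vu|uv] := tot v u.
  by exists u; split=> [|w]; rewrite inE ?us ?orbT // => /predU1P[->|/su].
exists v; split=> [|w]; rewrite inE ?eqxx // => /predU1P[->//|/su wu].
exact: tr wu uv.
Qed.

Lemma leading_monomial_binomial u v : u != v -> le v u ->
  leading_monomial le ('X_[K, u] - 'X_[K, v]) u.
Proof.
have [_ _ tot _ _] := le_order.
move=> uv vu; split=> [|w /msuppB_le].
  by rewrite mcoeff_msupp mcoeffB !mcoeffX eqxx [v == u]eq_sym (negPf uv) subr0 oner_neq0.
rewrite mem_cat !msuppX !inE => /orP[] /eqP-> //.
by have := tot u u; rewrite orbb.
Qed.

End ToricIdeal.

(** * From an arrangement to a lexicographic Groebner basis *)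

Fixpoint lex_le m (e : seq 'I_m) (u v : 'X_{1..m}) : bool :=
  if e is i :: e' then (u i < v i) || (u i == v i) && lex_le e' u v else true.

Lemma lex_le_total m (e : seq 'I_m) : total (lex_le e).
Proof.
by elim: e => // i e IH u v /=; case: ltngtP => //= _; apply: IH.
Qed.

Lemma lex_le_trans m (e : seq 'I_m) : transitive (lex_le e).
Proof.
elim: e => // i e IH v u w /=.
case/orP=> [uv|/andP[/eqP-> uv]] /orP[vw|/andP[/eqP vw' vw]].
- by rewrite (ltn_trans uv vw).
- by rewrite -vw' uv.
- by rewrite vw.
- by rewrite vw' eqxx (IH _ _ _ uv vw) orbT.
Qed.

Lemma lex_le_add2r m (e : seq 'I_m) u v w :
  lex_le e (u + w)%MM (v + w)%MM = lex_le e u v.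
Proof.
by elim: e => //= i e ->; rewrite !mnmDE ltn_add2r eqn_add2r.
Qed.

Lemma lex_le0 m (e : seq 'I_m) u : lex_le e 0%MM u.
Proof. by elim: e => //= i e ->; rewrite mnm0E andbT; case: (u i). Qed.

Lemma lex_le_first_difference m (e : seq 'I_m) u v :
  (forall i, i \in e) -> lex_le e v u -> v != u ->
  exists e1 i e2, [/\ e = e1 ++ i :: e2, {in e1, u =1 v} & v i < u i].
Proof.
move=> e_all vu; suff [//|eq_e] :
    (exists e1 i e2, [/\ e = e1 ++ i :: e2, {in e1, u =1 v} & v i < u i])
    \/ {in e, v =1 u}.
  by case/eqP; apply/mnmP => i; apply: eq_e.
elim: e vu {e_all} => [|i e IH] /=; first by right.
case/orP=> [lt_i|/andP[/eqP eq_i /IH[|eq_e]]].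
- by left; exists [::], i, e.
- case=> e1 [j [e2 [-> eq1 lt_j]]]; left; exists (i :: e1), j, e2; split=> //.
  by move=> k; rewrite inE => /predU1P[->|/eq1].
- by right=> k; rewrite inE => /predU1P[->|/eq_e].
Qed.

Lemma lex_monomial_order m (e : seq 'I_m) :
  (forall i, i \in e) -> monomial_order (lex_le e).
Proof.
move=> e_all; split=> [u v|||u|u v w]; last first.
- by rewrite lex_le_add2r.
- exact: lex_le0.
- exact: lex_le_total.
- exact: lex_le_trans.
case/andP=> uv vu; apply/eqP/idPn => /(lex_le_first_difference e_all uv).
case=> e1 [i [e2 [eE eq1 lt_i]]]; move: vu; rewrite {e_all uv}eE.
elim: e1 eq1 => [_|k e1 IH eq1] /=; first by rewrite ltnNge ltnW //= gtn_eqF.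
rewrite eq1 ?mem_head // ltnn eqxx /=; apply: IH => l le1.
by apply: eq1; rewrite inE le1 orbT.
Qed.

Lemma notin_drop_index (T : eqType) (s : seq T) x :
  uniq s -> x \notin drop (index x s).+1 s.
Proof.
elim: s => //= y s IH /andP[ys us]; case: eqVneq => [<-|_]; last exact: IH.
by rewrite drop0.
Qed.

(** Here [v] involves only variables after [i], so the comparison is decided
    no later than at [i]. *)
Lemma lex_le_pure_power m (e : seq 'I_m) i c (v : 'X_{1..m}) : uniq e -> i \in e -> 0 < c ->
  (forall k, k \notin drop (index i e).+1 e -> v k = 0) ->
  lex_le e v (U_(i) *+ c)%MM.
Proof.
move=> ue ie c0; elim: e ue ie => //= k e IH /andP[ke ue].
rewrite inE mnm1MnE [k == i]eq_sym; move: ke; case: eqVneq => /= [<-|ik] ke ie.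
  by rewrite drop0 mul1n => v0; rewrite v0 ?c0.
move=> v0; rewrite v0; last by apply: contra ke => /mem_drop.
by rewrite mul0n /=; apply: IH.
Qed.

Section Arrangement.

Variables (m : nat) (a : m.-tuple nat) (e : seq 'I_m).
Hypotheses (a_gt0 : forall i, 0 < tnth a i).
Hypotheses (e_uniq : uniq e) (e_all : forall i, i \in e).

Definition later_gcd i : nat :=
  \big[gcdn/0]_(k <- drop (index i e).+1 e) tnth a k.

(** The exponent [c] for which [x_i ^ c] has weight
    [lcm a_i (gcd a_(i+1) ... a_m)]. *)
Definition lcm_exponent i : nat := lcmn (tnth a i) (later_gcd i) %/ tnth a i.

Lemma size_arrangement : size e = m.
Proof.
rewrite -[RHS]size_enum_ord; apply/perm_size/uniq_perm; rewrite ?enum_uniq //.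
by move=> i; rewrite mem_enum e_all.
Qed.

Lemma weight_arrangement u : weight a u = \sum_(k <- e) u k * tnth a k.
Proof.
by rewrite big_uniq //=; apply: eq_bigl => i; rewrite e_all.
Qed.

Lemma mem_initial_part i : (i \in take m.-1 e) = ((index i e).+1 < size e).
Proof. by rewrite in_take // size_arrangement; have := ltn_ord i; lia. Qed.

Lemma lcm_exponent_gt0 i : i \in take m.-1 e -> 0 < lcm_exponent i.
Proof.
rewrite mem_initial_part => lt_i.
have g0 : 0 < later_gcd i.
  rewrite /later_gcd; case E: (drop _ e) => [|k s].
    by move: (size_drop (index i e).+1 e); rewrite E /= => /esym/eqP;
      rewrite subn_eq0 leqNgt lt_i.
  by rewrite big_cons gcdn_gt0 a_gt0.
by rewrite divn_gt0 // dvdn_leq ?dvdn_lcml // lcmn_gt0 a_gt0.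
Qed.

Lemma free_for_tail i : free_for [seq tnth a k | k <- e] ->
  i \in take m.-1 e ->
  exists2 v : 'X_{1..m},
    forall k, k \notin drop (index i e).+1 e -> v k = 0
  & weight a v = lcm_exponent i * tnth a i.
Proof.
rewrite mem_initial_part => fr lt_i.
have := fr (index i e); rewrite size_map => /(_ lt_i).
rewrite (nth_map i) ?index_mem // nth_index // -map_drop big_map.
case/(nat_span_weight _ _ (drop_uniq _ e_uniq)) => v v0 wv.
by exists v => //; rewrite wv divnK // dvdn_lcml.
Qed.

(** At the first index where [u] exceeds [v] the difference of the two weights
    is a multiple both of [a_i] and of the gcd of the later generators. *)
Lemma lex_larger_divisible u v : weight a u = weight a v ->
  lex_le e v u -> v != u ->
  exists2 i, i \in take m.-1 e & lcm_exponent i <= u i.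
Proof.
move=> uv vu /(lex_le_first_difference e_all vu)[e1 [i [e2 [eE eq1 lt_i]]]].
have e1i : i \notin e1.
  by have := e_uniq; rewrite eE cat_uniq /= negb_or => /and3P[_ /andP[]].
have idx : index i e = size e1 by rewrite eE index_cat (negPf e1i) /= eqxx addn0.
have tl : drop (index i e).+1 e = e2.
  by rewrite idx eE -cat_rcons drop_size_cat // size_rcons.
have uvE : u i * tnth a i + \sum_(k <- e2) u k * tnth a k =
           v i * tnth a i + \sum_(k <- e2) v k * tnth a k.
  move: uv; rewrite !weight_arrangement eE !big_cat !big_cons /=.
  under eq_big_seq => k /eq1-> do over.
  by move/addnI.
have dE : (u i - v i) * tnth a i =
    \sum_(k <- e2) v k * tnth a k - \sum_(k <- e2) u k * tnth a k.
  by rewrite mulnBl; move: uvE; lia.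
have d0 : 0 < (u i - v i) * tnth a i by rewrite muln_gt0 subn_gt0 lt_i a_gt0.
have gdvd w : later_gcd i %| \sum_(k <- e2) w k * tnth a k.
  rewrite /later_gcd tl; elim: (e2) => [|k s IH]; first by rewrite !big_nil.
  rewrite !big_cons dvdn_add ?dvdn_mull ?dvdn_gcdl //.
  exact: dvdn_trans (dvdn_gcdr _ _) IH.
exists i.
  rewrite mem_initial_part idx eE size_cat /=.
  case: (e2) dE d0 => [|? ? _ _ /=]; last by lia.
  by rewrite !big_nil => ->.
rewrite -(mulnK (u i) (a_gt0 i)); apply: leq_div2r.
apply: (@leq_trans ((u i - v i) * tnth a i)); last by rewrite leq_mul2r leq_subr orbT.
by apply: dvdn_leq => //; rewrite dvdn_lcm dvdn_mull //= dE dvdn_sub.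
Qed.

Local Open Scope ring_scope.

(** The binomials [x_i^(c_i) - x^(v_i)] for all indices [i] of the arrangement
    but the last: a leading monomial of the toric ideal exceeds some monomial of
    the same weight, so one of the [x_i^(c_i)] divides it. *)
Lemma free_for_groebner_basis (K : fieldType) :
  free_for [seq tnth a k | k <- e] ->
  exists G : seq {mpoly K[m]},
    [/\ groebner_basis (lex_le e) (@toric_ideal K m a) G, uniq G
      & size G = m.-1].
Proof.
move=> fr; have lex := lex_monomial_order e_all.
pose r := take m.-1 e; pose p i := (U_(i) *+ lcm_exponent i)%MM : 'X_{1..m}.
have /fin_all_exists[v vP] : forall i, exists v : 'X_{1..m}, i \in r ->
    [/\ weight a (p i) = weight a v, lex_le e v (p i) & p i != v].
  move=> i; have [ir|ir] := boolP (i \in r); last by exists 0%MM.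
  have [v v0 wv] := free_for_tail fr ir; have c0 := lcm_exponent_gt0 ir.
  exists v => _; split; first by rewrite wv weight1Mn.
    exact: lex_le_pure_power.
  apply: contraL c0 => /eqP/mnmP/(_ i); rewrite mnm1MnE eqxx mul1n => ->.
  by rewrite v0 ?notin_drop_index.
pose g i := 'X_[K, p i] - 'X_[K, v i].
have lead i : i \in r -> leading_monomial (lex_le e) (g i) (p i).
  by move=> /vP[_ le_i ne_i]; apply: leading_monomial_binomial.
exists [seq g i | i <- r]; split; last 2 first.
- rewrite map_inj_in_uniq ?take_uniq // => i j ir jr gij.
  have := leading_monomial_unique lex (lead i ir); rewrite gij => /(_ _ (lead j jr)).
  move=> /mnmP/(_ i); rewrite !mnm1MnE eqxx mul1n; case: eqVneq => // _.
  by rewrite mul0n => ci; have := lcm_exponent_gt0 ir; rewrite ci.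
- by rewrite size_map size_takel // size_arrangement leq_pred.
split.
- apply/mapP => -[i ir g0]; have [] := lead i ir.
  by rewrite -g0 msupp0.
- by move=> _ /mapP[i /vP[wi _ _] ->]; apply: toric_binomial.
move=> f; split; apply: initial_ideal_sub => h u Ih hu.
  have [uh hmax] := hu; have [w [wh wu ww]] := toric_ideal_partner Ih uh.
  have [i ir ci] := lex_larger_divisible (esym ww) (hmax w wh) wu.
  apply: (leading_initial_ideal (map_f g ir) (lead i ir)).
  apply/mnm_lepP => k; rewrite mnm1MnE.
  by case: eqVneq => [<-|]; rewrite ?mul1n ?mul0n.
apply: (leading_initial_ideal _ hu (lepm_refl u)).
by case/mapP: Ih => i /vP[wi _ _] ->; apply: toric_binomial.
Qed.

End Arrangement.

(** * From a Groebner basis with [m - 1] elements to an arrangement *)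

(** What is retained of the Groebner basis: pure powers [x_i^(c i)] for
    [i != j0], a smaller monomial [tail i] of the same weight for each of them,
    and the fact that every monomial which is not least in its weight is
    divisible by one of these powers. *)
Section TriangularTails.

Variables (m : nat) (a : m.-tuple nat) (le : rel 'X_{1..m}).
Variables (j0 : 'I_m) (c : 'I_m -> nat) (tail : 'I_m -> 'X_{1..m}).
Hypotheses (a_gt0 : forall i, 0 < tnth a i) (le_order : monomial_order le).
Hypothesis c_gt0 : forall i, i != j0 -> 0 < c i.
Hypothesis tail_weight : forall i, i != j0 -> weight a (tail i) = c i * tnth a i.
Hypothesis tail_le : forall i, i != j0 -> le (tail i) (U_(i) *+ c i)%MM.
Hypothesis tail_neq : forall i, i != j0 -> tail i != (U_(i) *+ c i)%MM.
Hypothesis reducible : forall u v, weight a u = weight a v -> le v u -> v != u ->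
  exists2 i, i != j0 & c i <= u i.

Lemma monomial_order_add u v u' v' : le u v -> le u' v' ->
  le (u + u')%MM (v + v')%MM.
Proof.
have [_ tr _ _ add] := le_order => uv uv'.
apply: (tr (v + u')%MM); first exact: add.
by rewrite ![(v + _)%MM]addmC; apply: add.
Qed.

Lemma normal_monomial_unique u v : weight a u = weight a v ->
  (forall i, i != j0 -> u i < c i) -> (forall i, i != j0 -> v i < c i) -> u = v.
Proof.
have [_ _ tot _ _] := le_order => uv u_lt v_lt; apply/eqP/idPn => ne.
have /orP[vu|vu] := tot v u.
  have [|i ij] := reducible uv vu; first by rewrite eq_sym.
  by rewrite leqNgt u_lt.
have [i ij] := reducible (esym uv) vu ne.
by rewrite leqNgt v_lt.
Qed.

(** If every variable of [C] occurred in the tail of a member of [C], consider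
    [P], the product of the [x_i^(c i)] over [C], and [Q], that of the tails.
    Then [Q < P] have the same weight, and each [x_i] with [i \in C] divides [Q].
    After cancellation of the common factor the larger side has exponents below
    [c i] everywhere, contradicting [reducible]. *)
Lemma exists_source (C : {set 'I_m}) : j0 \notin C -> C != set0 ->
  exists2 i, i \in C & forall k, k \in C -> tail k i = 0.
Proof.
have [anti tr tot _ add] := le_order => j0C /set0Pn[i0 i0C].
have Cj k : k \in C -> k != j0 by apply: contraTneq => ->.
have [/exists_inP[i iC /forall_inP Hi]|/exists_inPn no] :=
    boolP [exists i in C, [forall k in C, tail k i == 0]].
  by exists i => // k /Hi/eqP.
pose P := (\sum_(i in C) U_(i) *+ c i)%MM; pose Q := (\sum_(i in C) tail i)%MM.
have PQ : weight a P = weight a Q.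
  rewrite !weight_sum; apply: eq_bigr => i /Cj ij.
  by rewrite tail_weight // weight1Mn.
(* needed for [C] and, to get strictness, for [C] without [i0] *)
have le_sum (D : pred 'I_m) : (forall i, D i -> i \in C) ->
    le (\sum_(i | D i) tail i)%MM (\sum_(i | D i) U_(i) *+ c i)%MM.
  move=> DC; apply: (big_ind2 (fun x y => le x y)).
  - by have := tot 0%MM 0%MM; rewrite orbb.
  - by move=> ? ? ? ? h1 h2; apply: monomial_order_add.
  - by move=> i /DC/Cj; apply: tail_le.
have QP : le Q P by apply: le_sum.
have neQP : Q != P.
  apply: contra (tail_neq (Cj _ i0C)) => /eqP QPE; move: QPE (QPE).
  rewrite {1 2}/P {1 2}/Q (bigD1 i0) //= [X in _ = X](bigD1 i0) //=.
  set Q1 := (\sum_(i in C | _) tail i)%MM; set P1 := (\sum_(i in C | _) _)%MM.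
  move=> QPE _; have Q1P1 : le Q1 P1.
    by apply: le_sum => i /andP[].
  apply/eqP; apply: (@addIm _ Q1); apply: anti.
  rewrite add ?tail_le ?Cj //= QPE ![((_ *+ _) + _)%MM]addmC.
  exact: add.
have cancel u v : u = (u - v + [multinom minn (u i) (v i) | i < m])%MM.
  by apply/mnmP => i; rewrite mnmDE mnmBE mnmE; lia.
(* [M] is the gcd of the monomials [P] and [Q] *)
pose M := [multinom minn (P i) (Q i) | i < m].
have PE : P = (P - Q + M)%MM by exact: cancel.
have QE : Q = (Q - P + M)%MM.
  by rewrite [LHS](cancel Q P); congr (_ + _)%MM; apply/mnmP => i; rewrite !mnmE minnC.
have wPQ : weight a (P - Q)%MM = weight a (Q - P)%MM.
  by apply/eqP; rewrite -(eqn_add2r (weight a M)) -!weightD -PE -QE PQ.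
have neq : (Q - P)%MM != (P - Q)%MM.
  by apply: contra neQP => /eqP E; rewrite QE E -PE.
have leQP : le (Q - P)%MM (P - Q)%MM.
  have /orP[//|/(add _ _ M)] := tot (Q - P)%MM (P - Q)%MM.
  rewrite -PE -QE => PQ'; case/eqP: neQP.
  by apply: anti; rewrite QP.
have PiE i : P i = (i \in C) * c i.
  rewrite mnm_sumE; have [iC|iC] := boolP (i \in C).
    rewrite (bigD1 i) //= big1 ?addn0 => [|k /andP[_ ki]].
      by rewrite mnm1MnE eqxx.
    by rewrite mnm1MnE (negPf ki).
  rewrite big1 // => k kC; rewrite mnm1MnE; case: eqVneq => // ki.
  by rewrite -ki kC in iC.
have [i ij] := reducible wPQ leQP neq.
rewrite mnmBE PiE; have := c_gt0 ij; have [iC|_] := boolP (i \in C); last by lia.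
have /forall_inPn[k kC ki] := no i iC.
suff : 0 < Q i by lia.
by rewrite mnm_sumE (bigD1 k) //= addn_gt0 lt0n ki.
Qed.

(** Induction on [C]: place a source of [C] first, so that no remaining tail
    involves it, and arrange the rest. The last clause, existence of normal
    forms supported on [j0 |: C], is carried along because the step needs it to
    compare [x_i^d x_j0^M] with a normal monomial in the later variables. *)
Lemma free_arrangement (C : {set 'I_m}) : j0 \notin C ->
  (forall k l, k \in C -> l \notin j0 |: C -> tail k l = 0) ->
  exists e : seq 'I_m,
    [/\ uniq e, e =i j0 |: C, free_for [seq tnth a k | k <- e]
      & forall n, nat_span [seq tnth a k | k <- e] n ->
        exists w : 'X_{1..m},
          [/\ forall i, i != j0 -> w i < c i,
              forall l, l \notin j0 |: C -> w l = 0 & weight a w = n]].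
Proof.
move: {2}#|C| (erefl #|C|) => N; elim: N C => [|N IH] C cardC j0C closed.
  move/eqP: cardC; rewrite cards_eq0 => /eqP C0.
  exists [:: j0]; split=> // [l|n]; first by rewrite C0 setU0 !inE.
  case/nat_span_cons=> k [r [-> /nat_span_nil->]].
  exists (U_(j0) *+ k)%MM; split; last by rewrite weight1Mn addn0.
    by move=> i ij; rewrite mnm1MnE eq_sym (negPf ij) mul0n c_gt0.
  by move=> l; rewrite mnm1MnE C0 setU0 inE eq_sym => /negPf->.
have C0 : C != set0 by rewrite -card_gt0 cardC.
have [i iC src] := exists_source j0C C0.
have ij : i != j0 by apply: contraNneq j0C => <-.
have inC l : (l \in j0 |: C) = (l == i) || (l \in j0 |: C :\ i).
  by rewrite !inE; have [->|] := eqVneq l i; rewrite ?iC ?orbT.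
have ie : i \notin j0 |: C :\ i by rewrite !inE (negPf ij) eqxx.
have closed' k l : k \in C -> l \notin j0 |: C :\ i -> tail k l = 0.
  move=> kC ll; have [->|li] := eqVneq l i; first exact: src.
  by apply: closed => //; rewrite inC negb_or li.
have [|||e [ue eE fr_e nf_e]] := IH (C :\ i).
- by move: cardC; rewrite (cardsD1 i) iC => -[].
- by rewrite !inE (negPf j0C) andbF.
- by by move=> k l /setD1P[_ kC]; apply: closed'.
have supp_e l : (l \notin e) = (l \notin j0 |: C :\ i) by rewrite eE.
pose b := [seq tnth a k | k <- e].
have span_ci : nat_span b (c i * tnth a i).
  apply/(nat_span_weight _ _ ue); exists (tail i); last exact: tail_weight.
  by move=> l; rewrite supp_e; apply: closed'.
exists (i :: e); split=> /=.
- by rewrite supp_e ie.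
- by move=> l; rewrite inE inC eE.
- apply/free_for_cons; split=> // _.
  set g := \big[gcdn/0]_(y <- b) y.
  suff -> : lcmn (tnth a i) g = c i * tnth a i by [].
  have /dvdnP[d dE] := dvdn_lcml (tnth a i) g.
  have lcm_dvd : lcmn (tnth a i) g %| c i * tnth a i.
    by rewrite dvdn_lcm dvdn_mull //= dvdn_nat_span.
  have d_le : d * tnth a i <= c i * tnth a i.
    by rewrite -dE dvdn_leq // muln_gt0 c_gt0 // a_gt0.
  rewrite leq_pmul2r // in d_le.
  rewrite dE; congr (_ * _); apply/eqP; rewrite eqn_leq d_le leqNgt /=.
  apply/negP => d_lt.
  have d0 : 0 < d.
    have b0 : 0 < g.
      have : g %| tnth a j0.
        by apply: dvdn_nat_span; apply: mem_nat_span; rewrite map_f // eE !inE eqxx.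
      by apply: dvdn_gt0.
    have : 0 < lcmn (tnth a i) g by rewrite lcmn_gt0 a_gt0 b0.
    by rewrite dE muln_gt0 => /andP[].
  (* [d a_i] is a multiple of the later gcd but need not be in the later span;
     adding a multiple of [a_j0] puts it there, and the exponent of [x_j0] is
     unrestricted in a normal monomial *)
  have [||M /nf_e[w [w_lt w0 wE]]] :=
    @gcd_multiple_span b (tnth a j0) (d * tnth a i) (a_gt0 j0).
  + by move=> _ /mapP[k _ ->].
  + by rewrite -dE dvdn_lcmr.
  have /mnmP/(_ i) : (U_(i) *+ d + U_(j0) *+ M)%MM = w.
    apply: normal_monomial_unique => // [|l lj].
      by rewrite weightD !weight1Mn.
    rewrite mnmDE !mnm1MnE [j0 == l]eq_sym (negPf lj) addn0.
    by case: eqVneq => [<-|_]; rewrite ?mul1n // mul0n c_gt0.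
  rewrite mnmDE !mnm1MnE eqxx [j0 == i]eq_sym (negPf ij) addn0 mul1n w0 // => dz.
  by rewrite dz in d0.
- move=> n /nat_span_cons[q [r [-> sr]]].
  (* replace [x_i^(c i)] by its tail as often as possible *)
  have sr' : nat_span b (q %/ c i * (c i * tnth a i) + r).
    by apply: nat_spanD => //; apply: nat_spanM.
  have [w [w_lt w0 wE]] := nf_e _ sr'.
  exists (U_(i) *+ (q %% c i) + w)%MM; split.
  + move=> l lj; rewrite mnmDE mnm1MnE; case: eqVneq => [<-|_].
      by rewrite w0 // addn0 mul1n ltn_mod c_gt0.
    by rewrite mul0n w_lt.
  + move=> l; rewrite inC negb_or => /andP[li ll].
    by rewrite mnmDE mnm1MnE eq_sym (negPf li) w0.
  + rewrite weightD weight1Mn wE {3}(divn_eq q (c i)) mulnDl.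
    by rewrite mulnA addnCA addnA.
Qed.

End TriangularTails.

Section PureInitialIdeal.

Variables (K : fieldType) (m : nat) (a : m.-tuple nat).
Variables (le : rel 'X_{1..m}) (G : seq {mpoly K[m]}).
Hypotheses (a_gt0 : forall i, 0 < tnth a i) (le_order : monomial_order le).

(** The bound on [size G] is used through the number of leading monomials. *)
Lemma leading_monomials_seq : 0%R \notin G -> exists2 ls : seq 'X_{1..m},
  size ls = size G
  & forall u, u \in ls <-> exists2 g, g \in G & leading_monomial le g u.
Proof.
elim: G => [_|g s IH].
  by exists [::] => // u; split=> // -[].
rewrite inE negb_or eq_sym => /andP[/(leading_monomial_exists le_order)[v gv]].
case/IH=> ls lsz lsE; exists (v :: ls) => [|u]; first by rewrite /= lsz.
rewrite inE; split=> [/predU1P[->|/lsE[h hs hu]]|[h]].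
- by exists g; rewrite ?mem_head.
- by exists h; rewrite // inE hs orbT.
rewrite inE => /predU1P[-> gu|hs hu].
  by rewrite (leading_monomial_unique le_order gu gv) eqxx.
by apply/orP; right; apply/lsE; exists h.
Qed.

Hypothesis G_basis : groebner_basis le (@toric_ideal K m a) G.

Lemma groebner_basis_reducible u v : weight a u = weight a v ->
  le v u -> v != u ->
  exists g w, [/\ g \in G, leading_monomial le g w & (w <= u)%MM].
Proof.
move=> uv vu ne; have [_ _ inE] := G_basis.
apply: initial_ideal_leading; apply/inE.
apply: (leading_initial_ideal (toric_binomial K uv) _ (lepm_refl u)).
by apply: leading_monomial_binomial => //; rewrite eq_sym.
Qed.

Hypotheses (m_gt0 : 0 < m) (size_G : size G = m.-1).

(** Pigeonhole: distinct variables have distinct pure powers among the at most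
    [m - 1] leading monomials, and all variables but one do have such a power,
    which leaves no room for a leading monomial of another shape. *)
Lemma pure_power_leading_monomials :
  exists (j0 : 'I_m) (c : 'I_m -> nat),
    (forall i, i != j0 -> 0 < c i /\
      exists2 g, g \in G & leading_monomial le g (U_(i) *+ c i)%MM)
    /\ forall g u, g \in G -> leading_monomial le g u ->
      exists2 i, i != j0 & u = (U_(i) *+ c i)%MM.
Proof.
have [G0 G_toric _] := G_basis; have [anti _ tot min0 _] := le_order.
have [ls lsz lsE] := leading_monomials_seq G0.
have ls0 u : u \in ls -> u != 0%MM.
  case/lsE=> g gG [ug gu]; apply/eqP => u0.
  have [v [vg ne _]] := toric_ideal_partner (G_toric g gG) ug.
  case/eqP: ne; apply: anti; rewrite gu // u0.
  exact: min0.
(* a nonzero [u] satisfies [pure i u] iff it is a power of [x_i] *)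
pose pure i (u : 'X_{1..m}) := u == (U_(i) *+ u i)%MM.
pose p i := nth 0%MM ls (find (pure i) ls).
have pP i : has (pure i) ls -> [/\ p i \in ls, p i = (U_(i) *+ p i i)%MM & 0 < p i i].
  move=> hi; have pls : p i \in ls by rewrite mem_nth // -has_find.
  have pE : p i = (U_(i) *+ p i i)%MM by apply/eqP; exact: (nth_find 0%MM hi).
  split=> //; rewrite lt0n; apply: contra (ls0 _ pls) => /eqP p0.
  by rewrite pE p0.
have p_inj : {in [pred i | has (pure i) ls] &, injective p}.
  move=> i j; rewrite !inE => /pP[_ piE pi0] /pP[_ pjE _] pij.
  apply/eqP; apply: contraLR pi0 => ij.
  by rewrite pij pjE mnm1MnE eq_sym (negPf ij).
have two i j : i != j -> has (pure i) ls || has (pure j) ls.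
  pose u := (U_(i) *+ tnth a j)%MM; pose v := (U_(j) *+ tnth a i)%MM => ij.
  have dvd_pure k n w : (w <= U_(k) *+ n)%MM -> pure k w.
    move=> /mnm_lepP wk; apply/eqP/mnmP => l; rewrite mnm1MnE.
    case: eqVneq => [<-|kl]; first by rewrite mul1n.
    by have := wk l; rewrite mnm1MnE (negPf kl) leqn0 => /eqP.
  have uv : weight a u = weight a v by rewrite !weight1Mn mulnC.
  have ne : v != u.
    apply/eqP => /mnmP/(_ i); rewrite !mnm1MnE eqxx eq_sym (negPf ij) mul1n.
    by move=> aj0; have := a_gt0 j; rewrite -aj0.
  have /orP[vu|vu] := tot v u.
    have [g [w [gG gw /dvd_pure pw]]] := groebner_basis_reducible uv vu ne.
    by apply/orP; left; apply/hasP; exists w => //; apply/lsE; exists g.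
  rewrite eq_sym in ne.
  have [g [w [gG gw /dvd_pure pw]]] := groebner_basis_reducible (esym uv) vu ne.
  by apply/orP; right; apply/hasP; exists w => //; apply/lsE; exists g.
have p_uniq (s : seq 'I_m) : uniq s -> {in s, forall i, has (pure i) ls} ->
    uniq [seq p i | i <- s] /\ {subset [seq p i | i <- s] <= ls}.
  move=> us hs; split; last by move=> _ /mapP[i /hs/pP[? _ _] ->].
  by rewrite map_inj_in_uniq // => i j /hs hi /hs hj; apply: p_inj.
have [j0 j0P] : exists j0, ~~ has (pure j0) ls.
  apply/existsP; rewrite -negb_forall; apply/negP => /forallP all_pure.
  have [] := p_uniq (enum 'I_m) (enum_uniq _) (fun i _ => all_pure i).
  move=> up /(uniq_leq_size up); rewrite size_map size_enum_ord lsz size_G.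
  by case: (m) m_gt0 => // n _; rewrite ltnn.
have pure_i i : i != j0 -> has (pure i) ls.
  by move=> /two; rewrite (negPf j0P) orbF.
exists j0, (fun i => p i i); split=> [i /pure_i/pP[/lsE[g gG gi] pE p0]|g u gG gu].
  by split=> //; exists g => //; rewrite -pE.
have [|up sub] := p_uniq (enum (predC1 j0)) (enum_uniq _).
  by move=> i; rewrite mem_enum => /pure_i.
have [|_ lsp] := uniq_min_size up sub.
  by rewrite size_map -cardE cardC1 card_ord lsz size_G.
have : u \in ls by apply/lsE; exists g.
rewrite -lsp => /mapP[i]; rewrite mem_enum => ij ->.
by exists i => //; have [_ ] := pP i (pure_i i ij).
Qed.

Lemma groebner_basis_free_for : exists e : seq 'I_m,
  [/\ uniq e, forall i, i \in e & free_for [seq tnth a k | k <- e]].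
Proof.
have [_ G_toric _] := G_basis.
have [j0 [c [c_lead lead_c]]] := pure_power_leading_monomials.
have /fin_all_exists[tail tailP] : forall i, exists v : 'X_{1..m}, i != j0 ->
    [/\ weight a v = c i * tnth a i, le v (U_(i) *+ c i)%MM
      & v != (U_(i) *+ c i)%MM].
  move=> i; have [->|ij] := eqVneq i j0; first by exists 0%MM.
  have [_ [g gG [cg gc]]] := c_lead i ij.
  have [v [vg vc wv]] := toric_ideal_partner (G_toric g gG) cg.
  by exists v => _; rewrite wv weight1Mn gc.
have reducible u v : weight a u = weight a v -> le v u -> v != u ->
    exists2 i, i != j0 & c i <= u i.
  move=> uv vu ne.
  have [g [w [gG /(lead_c g w gG)[i ij ->] /mnm_lepP/(_ i)]]] :=
    groebner_basis_reducible uv vu ne.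
  by rewrite mnm1MnE eqxx mul1n; exists i.
have c_gt0 i : i != j0 -> 0 < c i by case/c_lead.
have tail_weight i : i != j0 -> weight a (tail i) = c i * tnth a i by case/tailP.
have tail_le i : i != j0 -> le (tail i) (U_(i) *+ c i)%MM by case/tailP.
have tail_neq i : i != j0 -> tail i != (U_(i) *+ c i)%MM by case/tailP.
have [||e [ue eE fr _]] := free_arrangement a_gt0 le_order c_gt0 tail_weight
  tail_le tail_neq reducible (C := [set~ j0]).
- by rewrite !inE eqxx.
- by move=> k l _; rewrite !inE orbN.
by exists e; split=> // i; rewrite eE !inE orbN.
Qed.

End PureInitialIdeal.

(** * The equivalence *)

Theorem theorem4p7 (K : fieldType) (S : nat -> Prop) (m : nat)
    (a : m.-tuple nat)
    (numS : numerical_semigroup S)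
    (properS : exists n : nat, ~ S n)
    (minA : minimal_generators S a) :
  free_semigroup S <->
  exists (le : rel 'X_{1..m}) (G : seq {mpoly K[m]}),
    [/\ monomial_order le, groebner_basis le (@toric_ideal K m a) G,
        uniq G & size G = m.-1].
Proof.
have a_gt0 i : 0 < tnth a i.
  exact: (minimal_generators_gt0 minA (mem_tnth i a)).
split=> [[b minb fr]|[le [G [le_order G_basis _ size_G]]]].
  have [ua _ _] := minA; have ab := minimal_generators_perm_eq minA minb.
  rewrite perm_sym in ab; have /tuple_permP[s bE] := ab.
  pose e := [seq s i | i <- enum 'I_m].
  have ue : uniq e by rewrite (map_inj_uniq perm_inj) enum_uniq.
  have e_all i : i \in e by rewrite -(permKV s i) map_f // mem_enum.
  have [|G [G_basis uG size_G]] := free_for_groebner_basis a_gt0 ue e_all K.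
    by move: fr; rewrite bE -map_comp.
  by exists (lex_le e), G; split=> //; apply: lex_monomial_order.
have [m0|m_gt0] := posnP m.
  by exists a => // i; rewrite size_tuple => lt_i; exfalso; lia.
have [e [ue e_all fr]] := groebner_basis_free_for a_gt0 le_order G_basis m_gt0 size_G.
exists [seq tnth a k | k <- e] => //; apply: perm_minimal_generators minA.
rewrite -{1}(map_tnth_enum a); apply: perm_map; apply: uniq_perm => //.
  exact: enum_uniq.
by move=> i; rewrite mem_enum e_all.
Qed.
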